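(* Let $\mathbf C$ be a category and $\mathcal M$ a collection of objects of $\mathbf C$. Suppose $F,G\colon\mathbf C\to\mathbf{Ch}_+^b$ are functors, $F$ is finitely based-free with respect to $\mathcal M$, and $G$ is based-acyclic with respect to $\mathcal M$. Then the following hold. (1) Any natural transformation $\phi_0\colon H_0\circ F\to H_0\circ G$ extends to a natural transformation $\phi\colon F\to G$ (i.e. there is a natural transformation $\phi$ inducing $\phi_0$ on $H_0$). (2) Suppose $\phi,\psi\colon F\to G$ are natural transformations that induce the same transformation $H_0\circ F\to H_0\circ G$. Then there exist a function $\delta\colon\mathbb Z\to\mathbb Z_{\ge0}$ and a family of natural chain homotopies $\{P_A\colon\phi_A\simeq\psi_A\}_{A\in\mathbf C}$ which is uniformly controlled by $\delta$.
   Context: $\mathbf{Ch}_+^b$ is the category whose objects are positive ($C_i=0$ for $i<0$) based chain complexes over $\mathbb Z$ (each $C_i$ is a free abelian group with a preferred basis) and whose morphisms are all degree-zero chain maps (not necessarily based). A chain map is based if it takes basis elements to basis elements. A functor $F\colon\mathbf C\to\mathbf{Ch}_+^b$ is: based if $F(f)$ is a based chain map for every morphism $f$; acyclic with respect to $\mathcal M$ if the chain complex $F(A)$ is acyclic (i.e. $H_i(F(A))=0$ for $i>0$) for each $A\in\mathcal M$; based-acyclic with respect to $\mathcal M$ if it is based and acyclic with respect to $\mathcal M$; based-free with respect to $\mathcal M$ if for each $i$ there is a collection $\mathcal M_i=\{(A_\lambda,c_\lambda)\}_\lambda$ with $A_\lambda\in\mathcal M$ and $c_\lambda\in F(A_\lambda)_i$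 such that for any object $A$ of $\mathbf C$ the elements $F(f)(c_\lambda)\in F(A)_i$, for $f\in\operatorname{Mor}(A_\lambda,A)$, are distinct and form the preferred basis of $F(A)_i$; finitely based-free if in addition each $\mathcal M_i$ is finite. A family of natural chain homotopies between natural transformations $\phi,\psi\colon F\to G$ is a family $P_A\colon F(A)_*\to G(A)_{*+1}$, functorial in $A$, with $P_A\partial+\partial P_A=\psi_A-\phi_A$ for each $A$. The diameter of a chain $u=\sum_\alpha n_\alpha e_\alpha$ in a based chain complex is $d(u)=\sum_\alpha|n_\alpha|$. The diameter function of a chain homotopy $P\colon C_*\to D_{*+1}$ is $d_P(k)=\max\{d(P(c))\mid c\in C_i \text{ a basis element},\ i\le k\}$. A family $\{P_A\}$ is uniformly controlled by $\delta$ if $d_{P_A}(k)\le\delta(k)$ for all $A$ and all $k$. *)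

(* Defs.v *)
From HB Require Import structures.
From mathcomp Require Import all_boot all_order all_algebra.
From mathcomp Require Import boolp classical_sets.
From mathcomp.multinomials Require Import freeg.

Set Implicit Arguments.
Unset Strict Implicit.
Unset Printing Implicit Defensive.

Import Order.TTheory GRing.Theory.
Import Quotient.Exports.
Local Open Scope ring_scope.
Local Open Scope quotient_scope.

Record category := Category {
  ob : Type;
  hom : ob -> ob -> Type;
  idm : forall A, hom A A;
  comp : forall A B E, hom B E -> hom A B -> hom A E;
  comp_idl : forall A B (f : hom A B), comp (idm B) f = f;
  comp_idr : forall A B (f : hom A B), comp f (idm A) = f;
  compA : forall A B E X (h : hom E X) (g : hom B E) (f : hom A B),
    comp h (comp g f) = comp (comp h g) f }.
Arguments hom : clear implicits.
Arguments idm : clear implicits.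
Arguments comp {c A B E} _ _.

Record functor (C D : category) := Functor {
  fobj :> ob C -> ob D;
  fmap : forall A B, hom C A B -> hom D (fobj A) (fobj B);
  fmap_id : forall A, fmap (idm C A) = idm D (fobj A);
  fmap_comp : forall A B E (g : hom C B E) (f : hom C A B),
    fmap (comp g f) = comp (fmap g) (fmap f) }.
Arguments fmap {C D} _ {A B} _.

Section CompFunctor.
Variables (C D E : category) (H : functor D E) (F : functor C D).

Lemma comp_functor_id A : fmap H (fmap F (idm C A)) = idm E (H (F A)).
Proof. by rewrite !fmap_id. Qed.

Lemma comp_functor_comp A B X (g : hom C B X) (f : hom C A B) :
  fmap H (fmap F (comp g f)) =
  comp (fmap H (fmap F g)) (fmap H (fmap F f)).
Proof. by rewrite !fmap_comp. Qed.

Definition comp_functor : functor C E :=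
  @Functor C E (fun A => H (F A)) (fun A B f => fmap H (fmap F f))
    comp_functor_id comp_functor_comp.
End CompFunctor.

Record nat_trans (C D : category) (F G : functor C D) := NatTrans {
  nt :> forall A, hom D (F A) (G A);
  nt_natural : forall A B (f : hom C A B),
    comp (nt B) (fmap F f) = comp (fmap G f) (nt A) }.

Section Whisker.
Variables (C D E : category) (H : functor D E) (F G : functor C D).
Variable phi : nat_trans F G.

Lemma whisker_natural A B (f : hom C A B) :
  comp (fmap H (phi B)) (fmap (comp_functor H F) f) =
  comp (fmap (comp_functor H G) f) (fmap H (phi A)).
Proof. by rewrite /= -!fmap_comp nt_natural. Qed.

Definition whisker : nat_trans (comp_functor H F) (comp_functor H G) :=
  @NatTrans C E (comp_functor H F) (comp_functor H G)
    (fun A => fmap H (phi A)) whisker_natural.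
End Whisker.

Lemma additive_ext (U V : zmodType) (f g : {additive U -> V}) :
  f =1 g -> f = g.
Proof.
case: f => f [[pf]]; case: g => g [[pg]] /= fg.
have efg : f = g by exact: funext.
by move: pf; rewrite efg => pf; rewrite (Prop_irrelevance pf pg).
Qed.

Definition Ab : category.
refine (@Category zmodType (fun U V => {additive U -> V})
  (fun U => idfun : {additive U -> U})
  (fun U V W g f => g \o f : {additive U -> W}) _ _ _);
by move=> *; apply: additive_ext.
Defined.

(* D : {freeg M} is a formal Z-linear combination of elements of M. *)
Definition linear_combination (M : zmodType) (D : {freeg M}) : M :=
  \sum_(b <- dom D) b *~ coeff b D.

Definition is_basis (M : zmodType) (B : set M) : Prop :=
  forall u : M, exists! D : {freeg M},
    {in dom D, forall b, B b} /\ linear_combination D = u.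

Record based_group := BasedGroup {
  bg_sort :> zmodType;
  basis : set bg_sort;
  basisP : is_basis basis }.

Definition coords (M : based_group) (u : M) : {freeg M} :=
  projT1 (cid (basisP u)).

Definition diameter (M : based_group) (u : M) : nat :=
  (\sum_(b <- dom (coords u)) `|coeff b (coords u)|)%N.

(* Positive based chain complexes: they are indexed by nat, the groups in
   negative degrees being zero. *)
Record chain_complex := ChainComplex {
  chains :> nat -> based_group;
  diff : forall i, {additive chains i.+1 -> chains i};
  diffK : forall i x, diff i (diff i.+1 x) = 0 }.
Arguments diff {c} i.

Record chain_map (C D : chain_complex) := ChainMap {
  cmap :> forall i, {additive C i -> D i};
  cmap_diff : forall i x, cmap i (diff i x) = diff i (cmap i.+1 x) }.

Lemma chain_map_ext (C D : chain_complex) (f g : chain_map C D) :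
  (forall i, f i =1 g i) -> f = g.
Proof.
case: f => f pf; case: g => g pg /= fg.
have efg : f = g by apply: functional_extensionality_dep => i; exact: additive_ext (fg i).
by move: pf; rewrite efg => pf; rewrite (Prop_irrelevance pf pg).
Qed.

Definition chain_map_id (C : chain_complex) : chain_map C C.
refine (@ChainMap C C (fun i => idfun) _); by [].
Defined.

Definition chain_map_comp (C D E : chain_complex)
  (g : chain_map D E) (f : chain_map C D) : chain_map C E.
refine (@ChainMap C E (fun i => g i \o f i : {additive C i -> E i}) _).
by move=> i x /=; rewrite !cmap_diff.
Defined.

Definition Chb : category.
refine (@Category chain_complex chain_map chain_map_id chain_map_comp _ _ _);
by move=> *; apply: chain_map_ext.
Defined.

Definition based_map (C D : chain_complex) (f : chain_map C D) : Prop :=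
  forall i b, basis b -> basis (f i b).

Definition is_cycle (C : chain_complex) (i : nat) : {pred C i} :=
  match i with
  | 0 => fun=> true
  | j.+1 => fun x => diff j x == 0
  end.
Arguments is_cycle : clear implicits.

Lemma is_cycle_zmod (C : chain_complex) (i : nat) : zmod_closed (is_cycle C i).
Proof.
case: i => [|i]; split=> //; rewrite ?unfold_in /= ?raddf0 //.
by move=> x y; rewrite !unfold_in /= raddfB => /eqP-> /eqP->; rewrite subrr.
Qed.

HB.instance Definition _ (C : chain_complex) (i : nat) :=
  GRing.isZmodClosed.Build (C i) (is_cycle C i) (is_cycle_zmod C i).

Record cycle (C : chain_complex) (i : nat) := Cycle {
  cycle_val : C i;
  cycle_valP : cycle_val \in is_cycle C i }.

HB.instance Definition _ (C : chain_complex) (i : nat) := [isSub for @cycle_val C i].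
HB.instance Definition _ (C : chain_complex) (i : nat) := [Choice of cycle C i by <:].
HB.instance Definition _ (C : chain_complex) (i : nat) := [SubChoice_isSubZmodule of cycle C i by <:].

Definition is_boundary (C : chain_complex) (i : nat) : {pred cycle C i} :=
  fun z => `[< exists x : C i.+1, diff i x = cycle_val z >].
Arguments is_boundary : clear implicits.

Lemma is_boundary_zmod (C : chain_complex) (i : nat) : zmod_closed (is_boundary C i).
Proof.
split=> [|z1 z2 /asboolP[x1 e1] /asboolP[x2 e2]]; apply/asboolP.
  by exists 0; rewrite raddf0 -[RHS](raddf0 (\val : cycle C i -> C i)).
by exists (x1 - x2); rewrite raddfB e1 e2 -[RHS](raddfB (\val : cycle C i -> C i)).
Qed.

HB.instance Definition _ (C : chain_complex) (i : nat) :=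
  GRing.isZmodClosed.Build (cycle C i) (is_boundary C i) (is_boundary_zmod C i).

Definition homology (C : chain_complex) (i : nat) : zmodType :=
  Quotient.quot (is_boundary C i).

Section HomologyMap.
Variables (C D : chain_complex) (f : chain_map C D) (i : nat).

Lemma cycle_map_subproof (z : cycle C i) : f i (cycle_val z) \in is_cycle D i.
Proof.
case: i z => [|j] [x xP] //=; move: xP; rewrite !unfold_in /= => /eqP x0.
by rewrite -cmap_diff x0 raddf0.
Qed.

Definition cycle_map (z : cycle C i) : cycle D i := Cycle (cycle_map_subproof z).

Definition homology_fun (x : homology C i) : homology D i :=
  \pi_(Quotient.quot (is_boundary D i)) (cycle_map (repr x)).
End HomologyMap.

Section HomologyFunctor.
Variable i : nat.
Local Notation pi C := (\pi_(Quotient.quot (is_boundary C i))).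

Lemma homology_fun_pi C D (f : chain_map C D) (z : cycle C i) :
  homology_fun f (pi C z) = pi D (cycle_map f z).
Proof.
apply/eqP; rewrite /homology_fun -Quotient.idealrBE.
set w := repr _.
have : w - z \in is_boundary C i.
  by rewrite Quotient.idealrBE /w reprK.
case/asboolP => x ex; apply/asboolP; exists (f i.+1 x).
rewrite -cmap_diff ex -[RHS]/(\val (cycle_map f w - cycle_map f z)).
by rewrite !raddfB.
Qed.

Lemma homology_fun_additive C D (f : chain_map C D) :
  zmod_morphism (@homology_fun C D f i).
Proof.
move=> x y; rewrite -[x]reprK -[y]reprK -[in LHS]raddfB !homology_fun_pi.
rewrite -[RHS]raddfB; congr (pi D _); apply: val_inj.
by rewrite raddfB /= !raddfB.
Qed.

HB.instance Definition _ C D (f : chain_map C D) :=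
  GRing.isZmodMorphism.Build _ _ (@homology_fun C D f i)
    (homology_fun_additive f).

Definition homology_map (C D : chain_complex) (f : chain_map C D) :
  {additive homology C i -> homology D i} := @homology_fun C D f i.

Lemma homology_map_id (C : chain_complex) :
  homology_map (chain_map_id C) = idm Ab (homology C i).
Proof.
apply: additive_ext => x /=; rewrite -[x]reprK homology_fun_pi.
by congr (pi C _); apply: val_inj.
Qed.

Lemma homology_map_comp C D E (g : chain_map D E) (f : chain_map C D) :
  homology_map (chain_map_comp g f) =
  comp (homology_map g : hom Ab _ _) (homology_map f).
Proof.
apply: additive_ext => x /=; rewrite -[x]reprK !homology_fun_pi.
by rewrite reprK; congr (pi E _); apply: val_inj.
Qed.

Definition homology_functor : functor Chb Ab :=
  @Functor Chb Ab (fun C => homology C i) homology_map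
    homology_map_id homology_map_comp.
End HomologyFunctor.

Definition acyclic (C : chain_complex) : Prop :=
  forall i, (0 < i)%N -> forall x : homology C i, x = 0.

Section Models.
Variables (C : category) (M : ob C -> Prop) (F : functor C Chb).

Definition based : Prop := forall A B (f : hom C A B), based_map (fmap F f).

Definition acyclic_wrt : Prop := forall A, M A -> acyclic (F A).

Definition based_acyclic_wrt : Prop := based /\ acyclic_wrt.

(* The family (Am l, c l), indexed by l : L, freely generates F in degree i. *)
Definition free_models (i : nat) (L : Type) (Am : L -> ob C)
    (c : forall l, (F (Am l) : chain_complex) i) : Prop :=
  (forall l, M (Am l)) /\
  forall A : ob C,
    let gen (lf : {l : L & hom C (Am l) A}) : (F A : chain_complex) i :=
      (fmap F (projT2 lf) : chain_map _ _) i (c (projT1 lf)) in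
    injective gen /\ range gen = @basis ((F A : chain_complex) i).

Definition based_free_wrt : Prop :=
  forall i, exists (L : Type) (Am : L -> ob C)
    (c : forall l, (F (Am l) : chain_complex) i), free_models c.

Definition finitely_based_free_wrt : Prop :=
  forall i, exists (L : finType) (Am : L -> ob C)
    (c : forall l, (F (Am l) : chain_complex) i), free_models c.
End Models.

Record chain_homotopy (C D : chain_complex) (f g : chain_map C D) :=
  ChainHomotopy {
    hmap :> forall i, {additive C i -> D i.+1};
    hmap0 : forall x : C 0, diff 0 (hmap 0 x) = g 0 x - f 0 x;
    hmapS : forall i (x : C i.+1),
      hmap i (diff i x) + diff i.+1 (hmap i.+1 x) = g i.+1 x - f i.+1 x }.

Section Diameter.
Variables (C D : chain_complex) (f g : chain_map C D).

Definition diameter_values (P : chain_homotopy f g) (k : int) : set nat :=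
  [set n | exists i (b : C i),
    [/\ i%:Z <= k, basis b & n = diameter (P i b)]].

(* m is the value at k of the diameter function of P. The maximum of an empty
   set is 0; an unbounded set has no maximum, so there is then no such m. *)
Definition is_diameter_at (P : chain_homotopy f g) (k : int) (m : nat) : Prop :=
  supremums (diameter_values P k) m.
End Diameter.

Section NaturalHomotopies.
Variables (C : category) (F G : functor C Chb) (phi psi : nat_trans F G).

Definition homotopy_family := forall A : ob C, chain_homotopy (phi A) (psi A).

Definition natural_homotopies (P : homotopy_family) : Prop :=
  forall (A B : ob C) (f : hom C A B) i (x : (F A : chain_complex) i),
    P B i ((fmap F f : chain_map _ _) i x) =
    (fmap G f : chain_map _ _) i.+1 (P A i x).

Definition uniformly_controlled (P : homotopy_family) (delta : int -> nat) :
    Prop :=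
  forall (A : ob C) (k : int),
    exists2 m, is_diameter_at (P A) k m & (m <= delta k)%N.
End NaturalHomotopies.

(* Main.v *)
From HB Require Import structures.
From mathcomp Require Import all_boot all_order all_algebra.
From mathcomp Require Import boolp classical_sets.
From mathcomp.multinomials Require Import freeg.
Require Import Defs.

Set Implicit Arguments.
Unset Strict Implicit.
Unset Printing Implicit Defensive.

Import Order.TTheory GRing.Theory.
Import Quotient.Exports.
Local Open Scope ring_scope.
Local Open Scope quotient_scope.

(** This is the method of acyclic models, with a record of the size of chains.

    Fix a degree i.  If F is based-free, then F in degree i is a free functor
    to abelian groups: by a Yoneda-type argument, a natural transformation out
    of it to any functor V is the same thing as an arbitrary choice, for each
    generator c, of an element of V at the model where c lives
    ([free_nat_trans_eq], [free_nat_trans_exists]).  Such a functor is projective relative to the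
    models: a natural transformation to W lifts through p : V -> W as soon as
    it lifts pointwise at the objects of M ([based_free_lift]).

    Both parts of the theorem are then inductions on the degree.  For the
    extension, degree 0 is a lift through the projection of the 0-chains of G
    onto H_0; degree i+1 is a lift of T_i d through d, and the elements to be
    lifted are boundaries at the models, in degree 0 because phi0 sends the
    class of a boundary to 0, and above because G is acyclic there.  For the
    homotopy, P_0 is a lift of psi - phi through d, which exists because the
    two agree on H_0, and P_(i+1) is a lift of psi - phi - P_i d, whose values
    are cycles.

    The uniform bound holds for every natural transformation P from the chains
    of F in one degree to those of G in another ([finite_free_diameter_bounded]): a basis element of
    F(A) is F(f)(c) for one of finitely many generators c, naturality gives
    P(F(f)(c)) = G(f)(P(c)), and the based map G(f) does not increase
    diameters, since it sends a combination of basis elements to one with the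
    same coefficients, possibly with collisions. *)

(** * Formal integral combinations *)

(** Two combinations have different supports; sums over them are compared
    after both are rewritten over one common list. *)
Lemma big_dom_widen (R : Type) (idx : R) (op : Monoid.com_law idx)
    (K : choiceType) (D : {freeg K}) (s : seq K) (F : K -> R) :
  uniq s -> {subset dom D <= s} -> (forall b, coeff b D = 0 -> F b = idx) ->
  \big[op/idx]_(b <- dom D) F b = \big[op/idx]_(b <- s) F b.
Proof.
move=> us sub F0; rewrite [RHS](bigID (mem (dom D))) /= [X in op _ X]big1 => [|b].
  rewrite Monoid.mulm1 -[RHS]big_filter; apply: perm_big; apply: uniq_perm.
  - exact: uniq_dom.
  - exact: filter_uniq.
  - by move=> b; rewrite mem_filter andb_idr //; exact: sub.
by move=> /coeff_outdom/F0.
Qed.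

Section CombinationSum.
Variables (K : choiceType) (V : zmodType) (f : K -> V).

Definition combination_sum (D : {freeg K}) : V :=
  \sum_(b <- dom D) f b *~ coeff b D.

Lemma combination_sum_widen D s : uniq s -> {subset dom D <= s} ->
  combination_sum D = \sum_(b <- s) f b *~ coeff b D.
Proof. by move=> us sub; apply: big_dom_widen => // b ->; rewrite mulr0z. Qed.

Lemma combination_sum_additive : zmod_morphism combination_sum.
Proof.
move=> D E; have us := undup_uniq (dom D ++ dom E).
rewrite !(combination_sum_widen us) => [|b|b|b].
- by rewrite -sumrB; apply: eq_bigr => b _; rewrite coeffB mulrzBr.
- by rewrite mem_undup mem_cat orbC => ->.
- by rewrite mem_undup mem_cat => ->.
- by move=> /domB; rewrite mem_undup.
Qed.

HB.instance Definition _ :=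
  GRing.isZmodMorphism.Build _ _ combination_sum combination_sum_additive.

Lemma combination_sumU b : combination_sum << b >> = f b.
Proof. by rewrite /combination_sum domU1 big_seq1 coeffU eqxx. Qed.

End CombinationSum.

Section L1Norm.
Variable K : choiceType.

Definition l1norm (D : {freeg K}) : nat := (\sum_(b <- dom D) `|coeff b D|)%N.

Lemma l1norm_widen D s : uniq s -> {subset dom D <= s} ->
  l1norm D = (\sum_(b <- s) `|coeff b D|)%N.
Proof. by move=> us sub; apply: big_dom_widen => // b ->. Qed.

(** The inequality can be strict, because coefficients may cancel. *)
Lemma l1normD (D E : {freeg K}) : (l1norm (D + E)%R <= l1norm D + l1norm E)%N.
Proof.
have us := undup_uniq (dom D ++ dom E).
rewrite !(l1norm_widen us) => [|b|b|b].
- rewrite -big_split /=; apply: leq_sum => b _.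
  by rewrite coeffD -lez_nat PoszD !abszE Num.Theory.ler_normD.
- by rewrite mem_undup mem_cat orbC => ->.
- by rewrite mem_undup mem_cat => ->.
- by move=> /domD_subset; rewrite mem_undup.
Qed.

Lemma l1normU n b : l1norm << n *g b >> = `|n|%N.
Proof.
have [->|n0] := eqVneq n 0; first by rewrite freegU0 /l1norm dom0 big_nil.
by rewrite /l1norm domU // big_seq1 coeffU eqxx mulr1.
Qed.

Lemma l1norm_sum (I : Type) (r : seq I) (D : I -> {freeg K}) :
  (l1norm (\sum_(i <- r) D i)%R <= \sum_(i <- r) l1norm (D i))%N.
Proof.
elim: r => [|i r IH]; first by rewrite !big_nil /l1norm dom0 big_nil.
by rewrite !big_cons (leq_trans (l1normD _ _)) // leq_add2l.
Qed.

End L1Norm.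

(** * Based abelian groups *)

Section BasedGroup.
Variable M : based_group.

Lemma coordsP (u : M) :
  {in dom (coords u), forall b, basis b} /\ linear_combination (coords u) = u.
Proof. by rewrite /coords; case: cid => D [? ?]. Qed.

Lemma coords_unique (u : M) (D : {freeg M}) :
  {in dom D, forall b, basis b} -> linear_combination D = u -> coords u = D.
Proof.
by move=> bD eD; rewrite /coords; case: cid => E /= [_ uniqE]; apply: uniqE.
Qed.

Lemma coords_basis (b : M) : basis b -> coords b = << b >>.
Proof.
move=> bb; apply: coords_unique; last exact: (combination_sumU id).
by move=> x; rewrite domU1 inE => /eqP ->.
Qed.

(** By uniqueness of coordinates: the difference of the coordinates is a
    combination of basis elements with the right value. *)
Lemma coords_additive : zmod_morphism (@coords M).
Proof.
move=> u v; have [bu eu] := coordsP u; have [bv ev] := coordsP v.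
apply: coords_unique => [b /domB|].
  by rewrite mem_cat => /orP[/bu|/bv].
by rewrite [LHS](combination_sum_additive id); congr (_ - _).
Qed.

HB.instance Definition _ :=
  GRing.isZmodMorphism.Build _ _ (@coords M) coords_additive.

Definition basis_extension (V : zmodType) (f : M -> V) : {additive M -> V} :=
  combination_sum f \o @coords M.

Lemma basis_extensionE (V : zmodType) (f : M -> V) (b : M) :
  basis b -> basis_extension f b = f b.
Proof. by move=> bb; rewrite /= coords_basis // combination_sumU. Qed.

Lemma additive_sum_coords (V : zmodType) (f : {additive M -> V}) (u : M) :
  f u = combination_sum f (coords u).
Proof.
rewrite -[in LHS](coordsP u).2 raddf_sum.
by apply: eq_bigr => b _; rewrite raddfMz.
Qed.

Lemma eq_on_basis (V : zmodType) (f g : {additive M -> V}) :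
  (forall b, basis b -> f b = g b) -> f =1 g.
Proof.
move=> fg u; rewrite (additive_sum_coords f) (additive_sum_coords g).
rewrite /combination_sum big_seq [RHS]big_seq.
by apply: eq_bigr => b /(coordsP u).1 /fg ->.
Qed.

End BasedGroup.

(** A based map carries the coordinates of u over to an expression of f u with
    the same coefficients; f may identify basis elements, hence only an
    inequality. *)
Lemma diameter_based (M N : based_group) (f : {additive M -> N}) (u : M) :
  (forall b, basis b -> basis (f b)) -> (diameter (f u) <= diameter u)%N.
Proof.
move=> fb; rewrite (additive_sum_coords f) -[diameter _]/(l1norm (coords _)).
rewrite raddf_sum; apply: leq_trans (l1norm_sum _ _) _.
rewrite /diameter big_seq [leqRHS]big_seq; apply: leq_sum => b /(coordsP u).1 /fb fbb.
by rewrite raddfMz /= (coords_basis fbb) freegU_mulz l1normU intz.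
Qed.

(** * Natural transformations *)

(** The type of states varies with the step: here the state at step i will be
    the component of degree i of a transformation, with its invariant. *)
Lemma dependent_choice_nat (S : nat -> Type) (R : forall i, S i -> S i.+1 -> Prop)
    (s0 : S 0) :
  (forall i s, exists s', R i s s') ->
  exists s : forall i, S i, s 0 = s0 /\ forall i, R i (s i) (s i.+1).
Proof.
move=> /(_ _ _)/cid step.
exists (nat_rect S s0 (fun i s => projT1 (step i s))); split=> // i /=.
by case: (step i _).
Qed.

Section NatTransOperations.
Variables (C D E : category).

Definition nt_comp (F G H : functor C D) (b : nat_trans G H) (a : nat_trans F G) :
  nat_trans F H.
Proof.
refine (@NatTrans C D F H (fun A => comp (b A) (a A)) _).
by move=> A B f; rewrite -compA nt_natural compA nt_natural -compA.
Defined.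

Definition nt_precomp (H K : functor D E) (a : nat_trans H K) (F : functor C D) :
  nat_trans (comp_functor H F) (comp_functor K F).
Proof.
refine (@NatTrans C E (comp_functor H F) (comp_functor K F) (fun A => a (F A)) _).
by move=> A B f; rewrite /= nt_natural.
Defined.

End NatTransOperations.

Local Notation "f $ x" := ((f : {additive _ -> _}) x)
  (at level 10, x at level 9, only parsing).

Lemma nt_naturalE (C : category) (V W : functor C Ab) (T : nat_trans V W) A B
    (f : hom C A B) (x : V A : zmodType) :
  T B $ (fmap V f $ x) = fmap W f $ (T A $ x).
Proof. exact: (congr1 (fun g : {additive _ -> _} => g x) (nt_natural T f)). Qed.

Definition nt_sub (C : category) (V W : functor C Ab) (S T : nat_trans V W) :
  nat_trans V W.
Proof.
refine (@NatTrans C Ab V W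
  (fun A => ((S A : {additive _ -> _}) \- (T A : {additive _ -> _}) : {additive _ -> _}))
  _).
move=> A B f; apply: additive_ext => x /=.
by rewrite !nt_naturalE [RHS]raddfB.
Defined.

Definition chains_functor (i : nat) : functor Chb Ab.
Proof.
by refine (@Functor Chb Ab (fun C : chain_complex => C i)
  (fun C D (f : chain_map C D) => f i) _ _); move=> *; apply: additive_ext.
Defined.

Definition diff_nt (i : nat) :
  nat_trans (chains_functor i.+1) (chains_functor i).
Proof.
refine (@NatTrans Chb Ab (chains_functor i.+1) (chains_functor i)
  (fun C : chain_complex => diff i : {additive C i.+1 -> C i}) _).
by move=> C D f; apply: additive_ext => x /=; rewrite cmap_diff.
Defined.

Local Notation chains_of F i := (comp_functor (chains_functor i) F).

(** * Free functors *)

Section FreeFunctor.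
Variables (C : category) (M : ob C -> Prop) (F : functor C Chb) (i : nat).
Variables (L : Type) (Am : L -> ob C).
Variable c : forall l, (F (Am l) : chain_complex) i.
Hypothesis freeF : free_models M c.

Local Notation Fi := (chains_of F i).

Lemma free_basisP A (b : Fi A) :
  basis (b : (F A : chain_complex) i) ->
  exists l (f : hom C (Am l) A), fmap Fi f $ (c l) = b.
Proof.
by have [_ eqB] := freeF.2 A; rewrite -eqB => -[[l f] _ <-]; exists l, f.
Qed.

(** Uniqueness half of the universal property: naturality propagates the values
    at the generators to all basis elements F(f)(c), and additivity to all
    chains. *)
Lemma free_nat_trans_eq (V : functor C Ab) (S T : nat_trans Fi V) :
  (forall l, S (Am l) $ (c l) = T (Am l) $ (c l)) ->
  forall A (x : (F A : chain_complex) i), S A $ x = T A $ x.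
Proof.
move=> eqST A; apply: eq_on_basis => b /free_basisP[l [f <-]].
by rewrite !nt_naturalE eqST.
Qed.

(** Existence half: send F(f)(c l) to V(f)(v l).  This is well defined on basis
    elements because a basis element determines the pair of l and f. *)
Lemma free_nat_trans_exists (V : functor C Ab)
    (v : forall l, V (Am l) : zmodType) :
  exists T : nat_trans Fi V, forall l, T (Am l) $ (c l) = v l.
Proof.
pose val A (b : (F A : chain_complex) i) : (V A : zmodType) :=
  if pselect (exists lf : {l : L & hom C (Am l) A},
     fmap Fi (projT2 lf) $ (c (projT1 lf)) = b) is left e
  then fmap V (projT2 (projT1 (cid e))) $ (v (projT1 (projT1 (cid e)))) else 0.
have valE A l (f : hom C (Am l) A) :
    val A (fmap Fi f $ (c l)) = fmap V f $ (v l).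
  rewrite /val; case: pselect => [e|[]]; last by exists (existT _ l f).
  case: cid => lf /= elf; have [inj _] := freeF.2 A.
  by have -> : lf = existT _ l f by exact: inj.
have extE A l (f : hom C (Am l) A) :
    basis_extension (@val A) (fmap Fi f $ (c l)) = fmap V f $ (v l).
  rewrite basis_extensionE ?valE //.
  by have [_ <-] := freeF.2 A; exists (existT _ l f).
have natural A B (f : hom C A B) :
  comp (basis_extension (@val B) : hom Ab (Fi B) (V B)) (fmap Fi f) =
  comp (fmap V f) (basis_extension (@val A) : hom Ab (Fi A) (V A)).
  apply: additive_ext; apply: eq_on_basis => _ /free_basisP[l [g <-]].
  rewrite -[LHS]/(basis_extension (@val B) (fmap Fi f $ (fmap Fi g $ (c l)))).
  rewrite -[RHS]/(fmap V f $ (basis_extension (@val A) (fmap Fi g $ (c l)))).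
  have <- : fmap Fi (comp f g) $ (c l) = fmap Fi f $ (fmap Fi g $ (c l)).
    by rewrite fmap_comp.
  by rewrite !extE fmap_comp.
exists (NatTrans natural) => l.
(* the generator c l is the basis element obtained from the identity *)
have e := extE (Am l) l (idm C (Am l)); rewrite !fmap_id in e; exact: e.
Qed.

End FreeFunctor.

(** Relative projectivity.  A preimage is chosen at each generator, which lives
    over a model; the universal property does the rest, and its uniqueness half
    shows that the result is a lift at every object. *)
Lemma based_free_lift (C : category) (M : ob C -> Prop) (F : functor C Chb)
    (i : nat) (V W : functor C Ab) (p : nat_trans V W)
    (S : nat_trans (chains_of F i) W) :
  based_free_wrt M F ->
  (forall A, M A -> forall x : (F A : chain_complex) i,
     exists v : (V A : zmodType), p A $ v = S A $ x) ->
  exists T : nat_trans (chains_of F i) V,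
    forall A (x : (F A : chain_complex) i), p A $ (T A $ x) = S A $ x.
Proof.
move=> /(_ i)[L [Am [c freeF]]] lift.
pose v l := cid (lift _ (freeF.1 l) (c l)).
have [T Tc] := free_nat_trans_exists freeF (fun l => projT1 (v l)).
exists T; apply: (free_nat_trans_eq freeF (S := nt_comp p T)) => l /=.
by rewrite Tc; exact: projT2 (v l).
Qed.

(** The bound is the largest diameter of a value at one of the finitely many
    generators: the value at F(f)(c) is the image under the based map G(f) of
    the value at c. *)
Lemma finite_free_diameter_bounded (C : category) (M : ob C -> Prop)
    (F G : functor C Chb) (i j : nat)
    (T : nat_trans (chains_of F i) (chains_of G j)) :
  finitely_based_free_wrt M F -> based G ->
  exists K : nat, forall A (b : (F A : chain_complex) i), basis b ->
    (diameter (T A $ b : (G A : chain_complex) j) <= K)%N.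
Proof.
move=> /(_ i)[L [Am [c freeF]]] basedG.
pose d l := diameter (T (Am l) $ (c l) : (G (Am l) : chain_complex) j).
exists (\max_l d l) => A b /(free_basisP freeF)[l [f <-]].
rewrite nt_naturalE; apply: leq_trans (leq_bigmax l).
by apply: (diameter_based (f := (fmap G f : chain_map _ _) j)) => b' /basedG; apply.
Qed.

(** * Homology *)

Lemma class0_subproof (C : chain_complex) (x : C 0) : x \in is_cycle C 0.
Proof. by []. Qed.

(** The projection onto H_0, where every 0-chain is a cycle.  It is needed on
    all 0-chains, and not on cycles, to be a transformation to lift through. *)
Definition class0 (C : chain_complex) (x : C 0) : homology C 0 :=
  \pi_(Quotient.quot (is_boundary C 0)) (Cycle (class0_subproof x)).

Lemma class0_additive C : zmod_morphism (@class0 C).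
Proof.
by move=> x y; rewrite -[RHS]raddfB; congr (\pi_ _ _); apply: val_inj; rewrite raddfB.
Qed.

HB.instance Definition _ C :=
  GRing.isZmodMorphism.Build _ _ (@class0 C) (@class0_additive C).

Lemma class0_surj (C : chain_complex) (h : homology C 0) :
  exists x, class0 x = h.
Proof.
exists (cycle_val (repr h)); rewrite -[RHS]reprK.
by congr (\pi_ _ _); apply: val_inj.
Qed.

Lemma class0_eq0 (C : chain_complex) (x : C 0) :
  class0 x = 0 <-> exists y, diff 0 y = x.
Proof.
rewrite -(raddf0 (@class0 C)); split=> [/eqP|[y dy]].
  rewrite /class0 -Quotient.idealrBE => /asboolP[y dy]; exists y.
  by rewrite dy [LHS](raddfB (\val : cycle C 0 -> C 0)) subr0.
apply/eqP; rewrite /class0 -Quotient.idealrBE; apply/asboolP; exists y.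
by rewrite dy [RHS](raddfB (\val : cycle C 0 -> C 0)) subr0.
Qed.

Lemma homology_map_class0 (C D : chain_complex) (f : chain_map C D) (x : C 0) :
  homology_map 0 f (class0 x) = class0 (f 0 x).
Proof.
by rewrite [LHS]homology_fun_pi; congr (\pi_ _ _); apply: val_inj.
Qed.

Definition class0_nt : nat_trans (chains_functor 0) (homology_functor 0).
Proof.
refine (@NatTrans Chb Ab (chains_functor 0) (homology_functor 0)
  (fun C : chain_complex => @class0 C : {additive C 0 -> homology C 0}) _).
by move=> C D f; apply: additive_ext => x /=; rewrite [RHS]homology_map_class0.
Defined.

Lemma acyclic_exact (C : chain_complex) (i : nat) (x : C i.+1) :
  acyclic C -> diff i x = 0 -> exists y, diff i.+1 y = x.
Proof.
move=> acC dx; have xZ : x \in is_cycle C i.+1 by exact/eqP.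
have /eqP := acC i.+1 isT (\pi_(Quotient.quot (is_boundary C i.+1)) (Cycle xZ)).
rewrite -(raddf0 \pi_(Quotient.quot (is_boundary C i.+1))) -Quotient.idealrBE.
move=> /asboolP[y dy]; exists y.
by rewrite dy [LHS](raddfB (\val : cycle C i.+1 -> C i.+1)) subr0.
Qed.

(** * Acyclic models *)

Lemma finitely_based_free_free (C : category) (M : ob C -> Prop)
    (F : functor C Chb) :
  finitely_based_free_wrt M F -> based_free_wrt M F.
Proof. by move=> finF i; have [L [Am [c freeF]]] := finF i; exists L, Am, c. Qed.

Section AcyclicModels.
Variables (C : category) (M : ob C -> Prop) (F G : functor C Chb).
Hypotheses (freeF : based_free_wrt M F) (acG : acyclic_wrt M G).

Local Notation dF i := (nt_precomp (diff_nt i) F).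
Local Notation dG i := (nt_precomp (diff_nt i) G).

(** The invariant [liftable] says that T d takes boundary values at the models,
    which is what the next lift requires.  It is inherited: if d T' = T d, then
    d T' d = T d d = 0, so the values of T' d are cycles, hence boundaries at
    the models, where G is acyclic. *)
Lemma extend_to_chain_map (T0 : nat_trans (chains_of F 0) (chains_of G 0)) :
  (forall A, M A -> forall x : (F A : chain_complex) 1,
    exists y : (G A : chain_complex) 1, diff 0 y = T0 A $ (diff 0 x)) ->
  exists phi : nat_trans F G, forall A (x : (F A : chain_complex) 0),
    (phi A : chain_map _ _) 0 x = T0 A $ x.
Proof.
pose liftable i (T : nat_trans (chains_of F i) (chains_of G i)) :=
  forall A, M A -> forall x : (F A : chain_complex) i.+1,
    exists y : (G A : chain_complex) i.+1, diff i y = T A $ (diff i x).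
pose compatible i (T : {T | liftable i T}) (T' : {T | liftable i.+1 T}) :=
  forall A (x : (F A : chain_complex) i.+1),
    diff i (projT1 T' A $ x : (G A : chain_complex) i.+1)
    = projT1 T A $ (diff i x).
move=> liftT0.
have step i T : exists T', @compatible i T T'.
  case: T => T liftT.
  have [T' dT'] := based_free_lift (p := dG i) (S := nt_comp T (dF i)) freeF liftT.
  suff liftT' : liftable i.+1 T' by exists (exist _ T' liftT').
  move=> A MA x; apply: acyclic_exact (acG MA) _.
  by rewrite [LHS]dT' /= diffK raddf0.
have [T [T0E dT]] := dependent_choice_nat (exist _ T0 liftT0) step.
pose phi A : chain_map (F A) (G A) :=
  @ChainMap (F A) (G A) (fun i => projT1 (T i) A) (fun i x => esym (dT i A x)).
have phi_natural A B (f : hom C A B) :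
    comp (phi B : hom Chb _ _) (fmap F f) = comp (fmap G f) (phi A : hom Chb _ _).
  by apply: chain_map_ext => i x; exact: (nt_naturalE (projT1 (T i)) f x).
by exists (NatTrans phi_natural) => A x /=; rewrite T0E.
Qed.

(** The degree 0 component lifts phi0 through the projection of G_0 onto H_0;
    it sends boundaries to boundaries because their classes vanish. *)
Lemma extend_H0_transformation
    (phi0 : nat_trans (comp_functor (homology_functor 0) F)
                      (comp_functor (homology_functor 0) G)) :
  exists phi : nat_trans F G,
    forall A, whisker (homology_functor 0) phi A = phi0 A.
Proof.
have [T0 cT0] : exists T0 : nat_trans (chains_of F 0) (chains_of G 0),
    forall A (x : (F A : chain_complex) 0),
    class0 (T0 A $ x : (G A : chain_complex) 0) = phi0 A $ (class0 x).
  apply: (based_free_lift (p := nt_precomp class0_nt G)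
    (S := nt_comp phi0 (nt_precomp class0_nt F)) freeF) => A _ x.
  exact: class0_surj.
have [A _ x|phi phiT0] := extend_to_chain_map (T0 := T0).
  apply/class0_eq0; rewrite cT0.
  suff -> : class0 (diff 0 x) = 0 by rewrite raddf0.
  by apply/class0_eq0; exists x.
exists phi => A; apply: additive_ext => h; have [x <-] := class0_surj h.
by rewrite [LHS]homology_map_class0 phiT0 cT0.
Qed.

Section Homotopy.
Variables phi psi : nat_trans F G.

Hypothesis eqH0 : forall A,
  whisker (homology_functor 0) phi A = whisker (homology_functor 0) psi A.

Definition difference i : nat_trans (chains_of F i) (chains_of G i) :=
  nt_sub (whisker (chains_functor i) psi) (whisker (chains_functor i) phi).

Lemma diff_difference i A (x : (F A : chain_complex) i.+1) :
  diff i (difference i.+1 A $ x : (G A : chain_complex) i.+1) =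
  difference i A $ (diff i x).
Proof. by rewrite [LHS]raddfB /= -!cmap_diff. Qed.

(** The [defect] psi - phi - P d of a component is what the next component
    has to bound.  The invariant [liftable] says that it takes values in
    cycles.  It is inherited: if d P' = psi - phi - P d, then
    d (psi - phi - P' d) = (psi - phi) d - (psi - phi - P d) d = 0. *)
Lemma natural_homotopy_components :
  exists P : forall i, nat_trans (chains_of F i) (chains_of G i.+1),
    (forall A (x : (F A : chain_complex) 0),
      diff 0 (P 0 A $ x : (G A : chain_complex) 1) = difference 0 A $ x) /\
    (forall i A (x : (F A : chain_complex) i.+1),
      P i A $ (diff i x) + diff i.+1 (P i.+1 A $ x : (G A : chain_complex) i.+2) =
      difference i.+1 A $ x).
Proof.
pose defect i (P : nat_trans (chains_of F i) (chains_of G i.+1)) :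
    nat_trans (chains_of F i.+1) (chains_of G i.+1) :=
  nt_sub (difference i.+1) (nt_comp P (dF i)).
pose liftable i (P : nat_trans (chains_of F i) (chains_of G i.+1)) :=
  forall A (x : (F A : chain_complex) i.+1),
    diff i (defect i P A $ x : (G A : chain_complex) i.+1) = 0.
pose compatible i (P : {P | liftable i P}) (P' : {P | liftable i.+1 P}) :=
  forall A (x : (F A : chain_complex) i.+1),
    diff i.+1 (projT1 P' A $ x : (G A : chain_complex) i.+2)
    = defect i (projT1 P) A $ x.
have step i P : exists P', @compatible i P P'.
  case: P => P liftP.
  have [A MA x|P' dP'] := based_free_lift (p := dG i.+1) (S := defect i P) freeF.
    exact: acyclic_exact (acG MA) (liftP A x).
  suff liftP' : liftable i.+1 P' by exists (exist _ P' liftP').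
  move=> A x; rewrite [LHS]raddfB diff_difference [X in _ - X]dP'.
  rewrite [X in _ - X](_ : _ = difference i.+1 A $ (diff i.+1 x)) ?subrr //.
  by rewrite /= diffK raddf0 subr0.
have [P0 dP0] : exists P0 : nat_trans (chains_of F 0) (chains_of G 1),
    forall A (x : (F A : chain_complex) 0),
    diff 0 (P0 A $ x : (G A : chain_complex) 1) = difference 0 A $ x.
  apply: (based_free_lift (p := dG 0) (S := difference 0) freeF) => A _ x.
  (* psi x - phi x is a boundary because its class in H_0 vanishes *)
  apply/class0_eq0; rewrite [LHS](raddfB (@class0 (G A))).
  apply/eqP; rewrite subr_eq0; apply/eqP.
  rewrite -[LHS](homology_map_class0 (psi A)) -[RHS](homology_map_class0 (phi A)).
  exact: (congr1 (fun h : {additive _ -> _} => h (class0 x)) (esym (eqH0 A))).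
have liftP0 : liftable 0 P0.
  by move=> A x; rewrite [LHS]raddfB diff_difference [X in _ - X]dP0 subrr.
have [P [P0E dP]] := dependent_choice_nat (exist _ P0 liftP0) step.
exists (fun i => projT1 (P i)); split=> [A x|i A x]; first by rewrite P0E dP0.
by rewrite dP addrC; exact: subrK.
Qed.

End Homotopy.
End AcyclicModels.

(** The diameter function at k involves only degrees up to k, so that degreewise
    bounds give a finite maximum; for negative k there is no basis element to
    bound and any value works. *)
Lemma uniformly_controlled_max (C : category) (F G : functor C Chb)
    (phi psi : nat_trans F G) (P : homotopy_family phi psi) (K : nat -> nat) :
  (forall A i (b : (F A : chain_complex) i), basis b ->
    (diameter (P A i b) <= K i)%N) ->
  uniformly_controlled P (fun k => \max_(i < `|k|.+1) K i)%N.
Proof.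
move=> PK A k; set d := (\max_(i < _) _)%N.
have ubd : ubound (diameter_values (P A) k) d.
  move=> n [i [b [ik bb ->]]]; apply: leq_trans (PK A i b bb) _.
  have ik' : (i < `|k|.+1)%N.
    by rewrite ltnS -lez_nat (le_trans ik) // abszE Num.Theory.ler_norm.
  exact: (leq_bigmax (Ordinal ik')).
have [m supm] := nat_supremums_neq0 (ex_intro _ d ubd).
by exists m => //; exact: supm.2.
Qed.

Theorem theorem4p3 (C : category) (M : ob C -> Prop) (F G : functor C Chb)
    (hF : finitely_based_free_wrt M F) (hG : based_acyclic_wrt M G) :
  (forall phi0 : nat_trans (comp_functor (homology_functor 0) F) (comp_functor (homology_functor 0) G),
     exists phi : nat_trans F G, forall A : ob C, whisker (homology_functor 0) phi A = phi0 A)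
  /\
  (forall phi psi : nat_trans F G,
     (forall A : ob C, whisker (homology_functor 0) phi A = whisker (homology_functor 0) psi A) ->
     exists (delta : int -> nat) (P : homotopy_family phi psi),
       natural_homotopies P /\ uniformly_controlled P delta).
Proof.
have freeF := finitely_based_free_free hF; have [basedG acG] := hG.
split=> [phi0|phi psi eqH0]; first exact: extend_H0_transformation freeF acG phi0.
have [P [dP0 dPS]] := natural_homotopy_components freeF acG eqH0.
pose K i := projT1 (cid (finite_free_diameter_bounded (P i) hF basedG)).
pose h : homotopy_family phi psi := fun A =>
  @ChainHomotopy _ _ (phi A) (psi A) (fun i => P i A) (dP0 A) (fun i => dPS i A).
exists (fun k => \max_(i < `|k|.+1) K i)%N, h; split.
  by move=> A B f i x; exact: (nt_naturalE (P i) f x).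
apply: uniformly_controlled_max => A i b bb.
rewrite /K; case: cid => Ki; exact.
Qed.
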